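(* Let $n\ge5$. Every planar $4$-uniform hypergraph $\mathcal H$ on $n$ vertices satisfies $\lambda(\mathcal H)\le\sqrt{2(n-2)}$, with equality if and only if $\mathcal H\cong\mathcal H(K_{2,n-2})$.
   Context: A closed $4$-angulation is a simple $2$-connected plane graph all of whose faces, the outer face included, are bounded by cycles of length $4$ (a quadrangulation of the sphere). For such a graph $G$, the face hypergraph $\mathcal H(G)$ is the $4$-uniform hypergraph on $V(G)$ whose edges are the vertex sets of all faces of $G$. A $4$-uniform hypergraph is planar if it is the face hypergraph of a closed $4$-angulation. $\mathcal H(K_{2,n-2})$ is the face hypergraph of the complete bipartite graph $K_{2,n-2}$ embedded in the plane: with parts $\{a,b\}$ and $\{u_1,\dots,u_{n-2}\}$, the edges are $\{a,b,u_i,u_{i+1}\}$ for $1\le i\le n-2$, indices modulo $n-2$. The spectral radius of a $k$-uniform hypergraph $\mathcal H$ on $n$ vertices (here $k=4$) is $$\lambda(\mathcal H)=\max\Bigl\{P_{\mathcal H}(x): x\in\mathbb R_{\ge0}^n,\ \sum_v x_v^k=1\Bigr\},\qquad P_{\mathcal H}(x)=k\sum_{e\in E(\mathcal H)}\prod_{v\in e}x_v .$$ *)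

(* Defs.v *)
From HB Require Import structures.
From mathcomp Require Import all_boot all_order all_algebra all_fingroup.
From mathcomp Require Import all_classical all_reals all_analysis.
Set Implicit Arguments.
Unset Strict Implicit.
Unset Printing Implicit Defensive.
Import Order.TTheory GRing.Theory Num.Theory.
Import numFieldNormedType.Exports.
Local Open Scope ring_scope.

Record sgraph (V : finType) := SGraph {
  adj :> rel V;
  adj_sym : symmetric adj;
  adj_irr : irreflexive adj }.

Definition connected_on (V : finType) (G : sgraph V) (A : {set V}) : Prop :=
  {in A &, forall u v,
     connect [rel x y | [&& G x y, x \in A & y \in A]] u v}.

Definition two_connected (V : finType) (G : sgraph V) : Prop :=
  [/\ (2 < #|V|)%N, connected_on G [set: V] &
      forall v : V, connected_on G [set~ v]].

Definition edges (V : finType) (G : sgraph V) : {set {set V}} :=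
  [set [set d.1; d.2] | d : V * V & G d.1 d.2].

(* An embedding in the sphere is given, up to homeomorphism, by its rotation
   system.  A dart is an edge with a direction, seen as leaving its first
   endpoint; the rotation lists cyclically the darts leaving each vertex. *)

Definition dart (V : finType) (G : sgraph V) : finType :=
  {d : V * V | G d.1 d.2}.

Definition tail (V : finType) (G : sgraph V) (d : dart G) : V := (val d).1.

Fact dart_rev_subproof (V : finType) (G : sgraph V) (d : dart G) :
  G (val d).2 (val d).1.
Proof. by rewrite adj_sym; exact: (valP d). Qed.

Definition dart_rev (V : finType) (G : sgraph V) (d : dart G) : dart G :=
  exist (fun d : V * V => G d.1 d.2)
    ((val d).2, (val d).1) (dart_rev_subproof d).

Lemma dart_revK (V : finType) (G : sgraph V) : involutive (@dart_rev V G).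
Proof. by move=> d; apply/val_inj => /=; case: (val d). Qed.

Record rotation (V : finType) (G : sgraph V) := Rotation {
  rotation_perm :> {perm dart G};
  tail_rotation : forall d, tail (rotation_perm d) = tail d;
  rotation_transitive : forall d d',
    tail d = tail d' -> d' \in porbit rotation_perm d }.

(* [face_perm s] sends a dart from [u] to [v] to [s] applied to the dart from
   [v] to [u]; its orbits are the facial walks, outer face included. *)
Definition face_perm (V : finType) (G : sgraph V) (s : rotation G) :
  {perm dart G} := (perm (can_inj (@dart_revK V G)) * s)%g.

Definition faces (V : finType) (G : sgraph V) (s : rotation G) :
  {set {set dart G}} := porbits (face_perm s).

(* Genus zero, by Euler's formula; meant for connected graphs. *)
Definition spherical (V : finType) (G : sgraph V) (s : rotation G) : Prop :=
  (#|V| + #|faces s| = #|edges G| + 2)%N.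

(* The facial walk has [k] steps and does not repeat a vertex. *)
Definition bounded_by_cycle (V : finType) (G : sgraph V) (k : nat)
    (f : {set dart G}) : Prop :=
  #|f| = k /\ {in f &, injective (@tail V G)}.

Definition closed_4_angulation (V : finType) (G : sgraph V) (s : rotation G) :
    Prop :=
  [/\ two_connected G, spherical s &
      forall f, f \in faces s -> bounded_by_cycle 4 f].

Definition hypergraph (V : finType) := {set {set V}}.

Definition hypergraph_iso (V W : finType) (H : hypergraph V)
    (H' : hypergraph W) : Prop :=
  exists2 f : V -> W, bijective f & [set f @: e | e : {set V} in H] = H'.

Definition face_hypergraph (V : finType) (G : sgraph V) (s : rotation G) :
  hypergraph V := [set [set tail d | d in f] | f : {set dart G} in faces s].

Definition planar_4_uniform (V : finType) (H : hypergraph V) : Prop :=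
  exists (G : sgraph V) (s : rotation G),
    closed_4_angulation s /\ H = face_hypergraph s.

(* The face hypergraph of K_{2,m}: [inl false] and [inl true] are a and b,
   [inr i] is u_i, and [ordS] is the successor modulo [m]. *)
Definition face_hypergraph_K2 (m : nat) : hypergraph (bool + 'I_m)%type :=
  [set [set inl false; inl true; inr i; inr (ordS i)] | i : 'I_m].

Definition hpoly (R : realType) (V : finType) (k : nat) (H : hypergraph V)
  (x : V -> R) : R := k%:R * \sum_(e in H) \prod_(v in e) x v.

Definition nonneg_sphere (R : realType) (V : finType) (k : nat) :
    set (V -> R) :=
  [set x | (forall v, 0 <= x v) /\ \sum_v x v ^+ k = 1]%classic.

(* The supremum is a maximum, see [spectral_radius_max]. *)
Definition spectral_radius (R : realType) (V : finType) (k : nat)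
    (H : hypergraph V) : R :=
  sup [set hpoly k H x | x in nonneg_sphere k]%classic.
Arguments spectral_radius R {V} k H.

Lemma spectral_radius_max (R : realType) (V : finType) (k : nat)
    (H : hypergraph V) :
  (0 < k)%N -> (0 < #|V|)%N ->
  exists2 x : V -> R, nonneg_sphere k x &
    spectral_radius R k H = hpoly k H x /\
    forall y : V -> R, nonneg_sphere k y -> hpoly k H y <= hpoly k H x.
Proof.
move=> k_gt0 V_gt0.
pose E (r : 'rV[R]_#|V|) (v : V) : R := r ord0 (enum_rank v).
have cE v : continuous (E ^~ v) by exact: coord_continuous.
have cS : continuous (fun r => \sum_v E r v ^+ k).
  apply: continuous_big => [|v _ r]; first exact: add_continuous.
  exact: (cvg_comp _ _ (cE v r) (@exprn_continuous R k _)).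
have cP : continuous (hpoly k H \o E).
  move=> r; apply: (@cvgM _ _ (nbhs r)); first exact: cvg_cst.
  suff: continuous (fun r => \sum_(e in H) \prod_(v in e) E r v) by apply.
  apply: continuous_big => [|e _]; first exact: add_continuous.
  by apply: continuous_big => [|v _]; [exact: mul_continuous|exact: cE].
pose A := [set r | nonneg_sphere k (E r)]%classic.
have AE r : A r -> forall i, `[0, 1]%classic (r ord0 i).
  move=> [r_ge0 r1] i; have := r_ge0 (enum_val i); rewrite /E enum_valK => ri0.
  rewrite /= in_itv /= ri0 /= -(@expr_le1 _ k) -?lt0n//.
  rewrite -r1 (bigD1 (enum_val i)) //= /E enum_valK lerDl sumr_ge0 // => v _.
  exact/exprn_ge0/r_ge0.
have A_compact : compact A.
  apply: (@subclosed_compact _ A _ _ (rV_compact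
    (fun=> @segment_compact R 0 1))) => //.
  rewrite (_ : A = (\bigcap_(v in setT) (E ^~ v @^-1` [set y | 0 <= y]))
      `&` ((fun r => \sum_v E r v ^+ k) @^-1` [set y | y = 1]))%classic; last first.
    apply/seteqP; split=> r [/= r0 r1]; split=> // v; [move=> _|]; exact: r0.
  apply: closedI.
    apply: closed_bigI => v _; apply: preimage_closed; last exact: closed_ge.
    by move=> r _; exact: cE.
  apply: preimage_closed; last exact: closed_eq.
  by move=> r _; exact: cS.
pose r_of (x : V -> R) : 'rV[R]_#|V| := \row_i x (enum_val i).
have r_ofK x : E (r_of x) = x.
  by apply/funext => v; rewrite /E mxE enum_rankK.
have A_neq0 : (A !=set0)%classic.
  case/card_gt0P: V_gt0 => v0 _.
  exists (r_of (fun v => (v == v0)%:R)); rewrite /A /= r_ofK; split => [v|].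
    exact: ler0n.
  rewrite (bigD1 v0) //= eqxx expr1n big1 ?addr0 // => v /negbTE->.
  by rewrite expr0n eqn0Ngt k_gt0.
have [c /set_mem Ac cmax] := EVT_max_rV A_neq0 A_compact
  (continuous_subspaceT cP).
have ub y : nonneg_sphere k y -> hpoly k H y <= hpoly k H (E c).
  by move=> Sy; have := cmax (r_of y); rewrite /= r_ofK; apply; rewrite inE /A /= r_ofK.
exists (E c) => //; split=> //; apply/eqP; rewrite eq_le; apply/andP; split.
  by apply: ge_sup => [|_ [y Sy <-]]; [exists (hpoly k H (E c)), (E c)|exact: ub].
apply: ub_le_sup; last by exists (E c).
by exists (hpoly k H (E c)) => _ [y Sy <-]; exact: ub.
Qed.

(* Main.v *)
Require Import Defs.
From mathcomp Require Import all_boot all_order all_algebra.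
From mathcomp Require Import all_fingroup ring lra zify.
From mathcomp Require Import reals.
Import Order.TTheory GRing.Theory Num.Theory.
Local Open Scope ring_scope.
Set Implicit Arguments.
Unset Strict Implicit.
Unset Printing Implicit Defensive.

(** The spectral radius of the face hypergraph is bounded by the largest
    adjacency eigenvalue of the quadrangulation G itself, and G is bipartite.

    On a face with consecutive vertices a, b, c, d, the inequality
    2pq <= p^2 + q^2, used for the two pairs of opposite edges, gives
    4 x_a x_b x_c x_d <= y_a y_b + y_b y_c + y_c y_d + y_d y_a with y = x^2.
    Every edge lies on two face sides, so summing over the faces gives
    P(x) <= 2 \sum_(uv edge) y_u y_v, where \sum_v y_v^2 = 1
    ([hpoly_face_le]).  In a bipartite graph with m edges, the Cauchy-Schwarz
    inequality bounds the right-hand side by \sqrt m, with equality only if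
    all pairs between the two classes are edges.  Both facts follow from one
    identity writing the defect as a sum of squares ([dart_sum_slack]).
    Euler's formula gives m = 2(n - 2).

    Bipartiteness is where the sphere matters: over 'F_2, Euler's formula says
    that the first cohomology of the surface vanishes ([euler_exact]), so the
    cochain equal to 1 on every edge, which sums to 0 around every even face,
    is the coboundary of a 2-colouring ([spherical_bipartite]).

    When the bound is attained, G is complete bipartite with class sizes p, q
    satisfying pq = 2(p + q - 2), that is (p - 2)(q - 2) = 0.  One class is
    therefore a pair {a, b}, every face is {a, b, u, u'} with u, u' consecutive
    around a, and the rotation at a numbers the other class cyclically, which
    is an isomorphism onto the face hypergraph of K_{2,n-2}
    ([complete_iso_K2]).  Conversely, weights constant on each class show that
    this hypergraph attains the bound ([spectral_radius_K2_ge]). *)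

(** * Exactness from Euler's formula *)

Lemma big_mem_type (R : nmodType) (I : finType) (X : I -> R) :
  \sum_(i in I) X i = \sum_i X i.
Proof. exact: eq_bigl. Qed.

(** A left kernel contained in the line spanned by the all-one vector costs at
    most one dimension. *)
Lemma rank_ge_of_const_ker (K : fieldType) (m p : nat) (A : 'M[K]_(m, p)) :
  (forall u : 'rV_m, u *m A = 0 -> forall i j, u 0 i = u 0 j) ->
  (m <= (\rank A).+1)%N.
Proof.
case: m A => [//|m] A kerA.
suff ker_le1 : (\rank (kermx A) <= 1)%N.
  by move: ker_le1; rewrite mxrank_ker; lia.
apply: leq_trans (rank_leq_row (const_mx 1 : 'rV[K]_m.+1)).
apply/mxrankS/row_subP => i.
have uA0 : row i (kermx A) *m A = 0 by apply/sub_kermxP; exact: row_sub.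
rewrite (_ : row i _ = row i (kermx A) 0 ord0 *: const_mx 1) ?scalemx_sub //.
by apply/rowP => j; rewrite !mxE mulr1; have := kerA _ uA0 j ord0; rewrite !mxE.
Qed.

(** Read [a] and [b] as the incidence matrices of a cell complex with vertices
    [V], edges [A] and faces [B].  The first hypothesis says that the boundary
    of a boundary vanishes; the next two, that the complex and its dual are
    connected, so that the coboundary maps have rank at least #|V| - 1 and
    #|B| - 1.  By Euler's formula these ranks add up to at least #|A|, which
    leaves no room between the image of the first map and the kernel of the
    second: every cocycle [h] is a coboundary. *)
Lemma euler_exact (K : fieldType) (V E F : finType)
    (A : {set E}) (B : {set F}) (a : V -> E -> K) (b : E -> F -> K) :
  (forall v f, f \in B -> \sum_(e in A) a v e * b e f = 0) ->
  (forall c : V -> K, (forall e, e \in A -> \sum_v c v * a v e = 0) ->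
     forall v w, c v = c w) ->
  (forall g : F -> K, (forall e, e \in A -> \sum_(f in B) b e f * g f = 0) ->
     {in B &, forall f f', g f = g f'}) ->
  (#|V| + #|B| = #|A| + 2)%N ->
  forall h : E -> K, (forall f, f \in B -> \sum_(e in A) h e * b e f = 0) ->
  exists c : V -> K, forall e, e \in A -> h e = \sum_v c v * a v e.
Proof.
move=> ab0 kera kerb euler h hb0.
pose M := \matrix_(i < #|V|, j < #|A|) a (enum_val i) (enum_val j).
pose N := \matrix_(i < #|A|, j < #|B|) b (enum_val i) (enum_val j).
have MN0 : M *m N = 0.
  apply/matrixP => i j; rewrite !mxE.
  rewrite -[RHS](ab0 (enum_val i) _ (enum_valP j)) [RHS]big_enum_val.
  by apply: eq_bigr => k _; rewrite !mxE.
have rankM : (#|V| <= (\rank M).+1)%N.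
  apply: rank_ge_of_const_ker => u uM0 i j.
  rewrite -(enum_valK i) -(enum_valK j).
  apply: (kera (fun v => u 0 (enum_rank v))) => e eA.
  have /rowP/(_ (enum_rank_in eA e)) := uM0; rewrite !mxE => sum0.
  rewrite -[RHS]sum0.
  rewrite -big_mem_type big_enum_val; apply: eq_bigr => k _.
  by rewrite mxE enum_valK enum_rankK_in.
have rankN : (#|B| <= (\rank N).+1)%N.
  rewrite -mxrank_tr; apply: rank_ge_of_const_ker => u uN0 i j.
  pose g f :=
    if f \in B =P true is ReflectT fB then u 0 (enum_rank_in fB f) else 0.
  have gE k : g (enum_val k) = u 0 k.
    rewrite /g; case: eqP => [kB|]; last by rewrite enum_valP.
    by rewrite enum_valK_in.
  rewrite -!gE; apply: kerb (enum_valP i) (enum_valP j) => e eA.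
  have /rowP/(_ (enum_rank_in eA e)) := uN0; rewrite !mxE => sum0.
  rewrite -[RHS]sum0.
  rewrite [LHS]big_enum_val; apply: eq_bigr => k _.
  by rewrite !mxE gE enum_rankK_in // mulrC.
pose r : 'rV_#|A| := \row_j h (enum_val j).
have rN0 : r *m N = 0.
  apply/rowP => j; rewrite !mxE -[RHS](hb0 _ (enum_valP j)) [RHS]big_enum_val.
  by apply: eq_bigr => k _; rewrite !mxE.
have MkerN : (M <= kermx N)%MS by apply/sub_kermxP.
have : (kermx N <= M)%MS.
  rewrite -(mxrank_leqif_sup MkerN) eqn_leq (mxrankS MkerN) mxrank_ker /=.
  have arith (x y i j z : nat) : (x <= i.+1 -> y <= j.+1 -> x + y = z + 2 ->
      z - j <= i)%N by lia.
  exact: arith rankM rankN euler.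
move/(submx_trans (introT sub_kermxP rN0)) => /submxP[u ru].
exists (fun v => u 0 (enum_rank v)) => e eA.
have /rowP/(_ (enum_rank_in eA e)) := ru; rewrite !mxE enum_rankK_in // => ->.
rewrite -[RHS]big_mem_type [RHS]big_enum_val; apply: eq_bigr => k _.
by rewrite mxE enum_valK enum_rankK_in.
Qed.

(** * Darts, edges and faces *)

Definition tip (V : finType) (G : sgraph V) (d : dart G) : V := (val d).2.

Lemma adj_tip (V : finType) (G : sgraph V) (d : dart G) : G (tail d) (tip d).
Proof. exact: valP d. Qed.

Lemma tail_neq_tip (V : finType) (G : sgraph V) (d : dart G) :
  tail d != tip d.
Proof. by apply/eqP => dd; have := adj_tip d; rewrite dd adj_irr. Qed.

Lemma dart_inj (V : finType) (G : sgraph V) (d d' : dart G) :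
  tail d = tail d' -> tip d = tip d' -> d = d'.
Proof.
rewrite /tail /tip => dd' ee'; apply/val_inj; move: dd' ee'.
by case: (val d) (val d') => u v [u' v'] /= -> ->.
Qed.

Lemma tail_face_perm (V : finType) (G : sgraph V) (s : rotation G) d :
  tail (face_perm s d) = tip d.
Proof. by rewrite /face_perm permM permE tail_rotation. Qed.

Lemma face_perm_rev (V : finType) (G : sgraph V) (s : rotation G) d :
  face_perm s (dart_rev d) = s d.
Proof. by rewrite /face_perm permM permE dart_revK. Qed.

Definition edge_of (V : finType) (G : sgraph V) (d : dart G) : {set V} :=
  [set tail d; tip d].

Lemma edge_of_in (V : finType) (G : sgraph V) (d : dart G) :
  edge_of d \in edges G.
Proof. by apply/imsetP; exists (val d) => //; rewrite inE; exact: valP d. Qed.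

Lemma edgeP (V : finType) (G : sgraph V) e :
  e \in edges G -> exists d : dart G, e = edge_of d.
Proof.
by case/imsetP => uv; rewrite inE => adj ->; exists (exist _ uv adj).
Qed.

Lemma edge_of_eq (V : finType) (G : sgraph V) (d d' : dart G) :
  (edge_of d' == edge_of d) = (d' == d) || (d' == dart_rev d).
Proof.
apply/eqP/orP => [ee|[/eqP->//|/eqP->]]; last by rewrite /edge_of setUC.
have: tail d' \in edge_of d by rewrite -ee !inE eqxx.
have: tip d' \in edge_of d by rewrite -ee !inE eqxx orbT.
have := tail_neq_tip d'; rewrite !inE.
move=> neq /orP[]/eqP t /orP[]/eqP t'; move: neq; rewrite ?t ?t' ?eqxx // => _.
  by right; apply/eqP/dart_inj; rewrite ?t ?t'.
by left; apply/eqP/dart_inj; rewrite ?t ?t'.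
Qed.

Lemma dart_rev_neq (V : finType) (G : sgraph V) (d : dart G) : dart_rev d != d.
Proof.
apply/eqP => /(congr1 (@tail V G)) rd.
by have /eqP[] := tail_neq_tip d; rewrite -rd.
Qed.

Lemma sum_edge_of (R : nmodType) (V : finType) (G : sgraph V) (d : dart G)
    (X : dart G -> R) :
  \sum_(d' | edge_of d' == edge_of d) X d' = X d + X (dart_rev d).
Proof.
rewrite (bigD1 d) ?eqxx //= (bigD1 (dart_rev d)) /=.
  rewrite big1 ?addr0 // => d'; rewrite edge_of_eq.
  by case: (d' == d) => //=; case: (d' == dart_rev d).
by rewrite edge_of_eq eqxx orbT dart_rev_neq.
Qed.

Lemma card_darts_edges (V : finType) (G : sgraph V) :
  #|dart G| = (2 * #|edges G|)%N.
Proof.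
transitivity (\sum_(d : dart G) 1)%N; first by rewrite sum1_card.
have edges_d (d : dart G) : predT d -> edge_of d \in edges G.
  by move=> _; exact: edge_of_in.
rewrite (partition_big (@edge_of V G) [in edges G] edges_d) /=.
rewrite mulnC -sum_nat_const; apply: eq_bigr => _ /edgeP[d ->].
by rewrite (sum_edge_of _ (fun=> 1%N)).
Qed.

Lemma partition_porbits (T : finType) (p : {perm T}) :
  partition (porbits p) [set: T].
Proof.
have -> : porbits p = equivalence_partition
    (fun x y => y \in porbit p x) [set: T].
  apply/setP => f; apply/imsetP/imsetP => -[x _ ->]; exists x => //.
    by apply/setP => y; rewrite !inE.
  by apply/setP => y; rewrite !inE.
apply/equivalence_partitionP => x y z _ _ _; rewrite porbit_id; split=> //.
by rewrite -eq_porbit_mem => /eqP <-.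
Qed.

Lemma sum_faces (R : nmodType) (V : finType) (G : sgraph V) (s : rotation G)
    (X : dart G -> R) :
  \sum_(f in faces s) \sum_(d in f) X d = \sum_d X d.
Proof.
rewrite -(set_partition_big _ (partition_porbits (face_perm s))).
by apply: eq_bigl => d; rewrite inE.
Qed.

(** * Even spherical maps are bipartite *)

Lemma connected_ind (V : finType) (G : sgraph V) (P : V -> Prop) (u : V) :
  connected_on G [set: V] -> P u -> (forall x y, G x y -> P x -> P y) ->
  forall v, P v.
Proof.
move=> conn Pu stepP v.
have /connectP[p] := conn u v (in_setT _) (in_setT _).
elim: p u Pu => [|w p IHp] u Pu /= => [_ -> //|/andP[/andP[Guw _] pathp]].
by apply: IHp pathp; exact: stepP Pu.
Qed.

Lemma dart_from (V : finType) (G : sgraph V) :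
  connected_on G [set: V] -> (1 < #|V|)%N ->
  forall v, exists d : dart G, tail d = v.
Proof.
move=> conn V_gt1 v.
have [d /eqP <-|no_dart] := pickP (fun d : dart G => tail d == v).
  by exists d.
have all_v w : w = v.
  apply: (connected_ind (P := fun w => w = v) conn (erefl v)) => x y Gxy xv.
  by have := no_dart (exist _ (x, y) Gxy); rewrite /tail /= xv eqxx.
move: V_gt1; rewrite ltnNge (eq_card1 (x := v)) // => w.
by rewrite (all_v w) !inE eqxx.
Qed.

(** Connectedness of the dual graph, in the form in which it is used: reversal
    and the face permutation generate the rotation, hence act transitively on
    the darts of a connected graph. *)
Lemma dart_invariant_const (T : Type) (V : finType) (G : sgraph V)
    (s : rotation G) (X : dart G -> T) :
  connected_on G [set: V] -> (forall d, X (dart_rev d) = X d) ->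
  (forall d, X (face_perm s d) = X d) -> forall d d', X d = X d'.
Proof.
move=> conn Xrev Xface.
have Xs d : X (s d) = X d by rewrite -face_perm_rev Xface Xrev.
have Xtail d d' : tail d = tail d' -> X d = X d'.
  move=> /rotation_transitive -/(_ s) /porbitP[i ->].
  by elim: i => [|i IHi]; rewrite ?expg0 ?perm1 // expgSr permM Xs.
move=> d d'; apply/esym.
pose P v := forall e, tail e = v -> X e = X d.
suff allP v : P v by exact: allP.
move: v; apply: (connected_ind (u := tail d) conn) => [|x y Gxy Px] e.
  exact: Xtail.
move=> ey; rewrite -(Px (exist _ (x, y) Gxy) erefl) -[RHS]Xrev; exact: Xtail.
Qed.

Lemma face_permE (V : finType) (G : sgraph V) (s : rotation G) f d :
  f \in faces s -> d \in f -> f = porbit (face_perm s) d.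
Proof.
by case/imsetP => d0 _ -> dd0; apply/eqP; rewrite eq_porbit_mem porbit_sym.
Qed.

Lemma sum_face_tip (R : nmodType) (V : finType) (G : sgraph V) (s : rotation G)
    f (X : V -> R) :
  f \in faces s -> \sum_(d in f) X (tip d) = \sum_(d in f) X (tail d).
Proof.
move=> fF; rewrite [RHS](reindex_inj (@perm_inj _ (face_perm s))) /=.
apply: eq_big => [d|d _]; last by rewrite tail_face_perm.
case/imsetP: fF => d0 _ ->.
by rewrite -!eq_porbit_mem -[in LHS](porbit_perm _ 1 d) expg1.
Qed.

Lemma sum_edge_ends (R : nzRingType) (V : finType) (G : sgraph V) (d : dart G)
    (X : V -> R) :
  \sum_v X v * (v \in edge_of d)%:R = X (tail d) + X (tip d).
Proof.
transitivity (\sum_(v in edge_of d) X v); last first.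
  by rewrite /edge_of big_setU1 ?big_set1 // inE tail_neq_tip.
rewrite [RHS]big_mkcond; apply: eq_bigr => v _.
by case: (v \in _); rewrite ?mulr1 ?mulr0.
Qed.

Lemma addrr_F2 (x : 'F_2) : x + x = 0.
Proof. by apply/val_inj; case: x => [[|[|]]]. Qed.

Lemma addr_eq0_F2 (x y : 'F_2) : x + y = 0 -> x = y.
Proof.
move/eqP; rewrite addr_eq0 => /eqP->; apply/eqP.
by rewrite eq_sym -addr_eq0 addrr_F2.
Qed.

(** [euler_exact] applied over 'F_2 to the cochain equal to 1 on every edge:
    it is a cocycle because the faces have even length, and a function of which
    it is the coboundary is a proper 2-colouring. *)
Lemma spherical_bipartite (V : finType) (G : sgraph V) (s : rotation G) :
  connected_on G [set: V] -> spherical s ->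
  (forall f, f \in faces s -> ~~ odd #|f|) ->
  exists c : V -> bool, forall d : dart G, c (tail d) != c (tip d).
Proof.
move=> conn euler even_face.
pose a (v : V) (e : {set V}) : 'F_2 := (v \in e)%:R.
(* An edge may occur twice along a face, and then counts as 0. *)
pose b (e : {set V}) (f : {set dart G}) : 'F_2 :=
  \sum_(d in f) (edge_of d == e)%:R.
have sum_b (X : {set V} -> 'F_2) f :
    \sum_(e in edges G) X e * b e f = \sum_(d in f) X (edge_of d).
  under eq_bigr do rewrite mulr_sumr.
  rewrite exchange_big; apply: eq_bigr => d _.
  rewrite (bigD1 (edge_of d)) ?edge_of_in //= eqxx mulr1 big1 ?addr0 // => e.
  by case/andP => _; rewrite eq_sym => /negbTE ->; rewrite mulr0.
have a_edge (c : V -> 'F_2) (d : dart G) :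
    \sum_v c v * a v (edge_of d) = c (tail d) + c (tip d).
  exact: sum_edge_ends.
have [||||c c1] := @euler_exact 'F_2 V _ _ (edges G) (faces s) a b _ _ _ euler
    (fun=> 1).
- move=> v f fF; rewrite sum_b.
  rewrite (eq_bigr (fun d => (v == tail d)%:R + (v == tip d)%:R)) => [|d _].
    rewrite big_split /= (sum_face_tip (fun w => (v == w)%:R) fF) /=.
    exact: addrr_F2.
  rewrite /a !inE; have := tail_neq_tip d.
  by case: (v =P tail d) => [->|_] => [/negbTE->|_]; rewrite ?addr0 ?add0r.
- move=> c c0 v w; apply/esym; move: w.
  apply: (connected_ind (u := v) conn) => // w x Gwx <-.
  apply/esym/addr_eq0_F2.
  by have := c0 _ (edge_of_in (exist _ (w, x) Gwx)); rewrite a_edge.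
- move=> g g0.
  have g_rev d :
      g (porbit (face_perm s) (dart_rev d)) = g (porbit (face_perm s) d).
    apply/esym/addr_eq0_F2; rewrite -[RHS](g0 _ (edge_of_in d)).
    rewrite -(sum_edge_of d (fun d' => g (porbit (face_perm s) d'))).
    rewrite big_mkcond /= -(sum_faces s).
    apply: eq_bigr => f fF; rewrite mulr_suml; apply: eq_bigr => d' d'f.
    rewrite -(face_permE fF d'f).
    by case: (_ == _); rewrite ?mul1r ?mul0r.
  have g_face d :
      g (porbit (face_perm s) (face_perm s d)) = g (porbit (face_perm s) d).
    by congr g; have := porbit_perm (face_perm s) 1 d; rewrite expg1.
  move=> f f' /imsetP[d _ ->] /imsetP[d' _ ->].
  exact: (dart_invariant_const (X := fun d => g (porbit (face_perm s) d)) conn).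
- move=> f fF; rewrite sum_b sumr_const.
  rewrite -(odd_double_half #|f|) (negbTE (even_face f fF)) add0n -mul2n mulrnA.
  by rewrite (_ : 1 *+ 2 = 0 :> 'F_2) ?mul0rn //; exact: addrr_F2.
exists (fun v => c v == 0) => d.
have := c1 _ (edge_of_in d); rewrite a_edge.
case: (c (tail d)) (c (tip d)) => [[|[|]] // ?] [[|[|]] // ?];
  by move=> /(congr1 val).
Qed.

(** * From the hypergraph to the graph *)

Lemma big_porbit (R : Type) (idx : R) (op : Monoid.com_law idx) (T : finType)
    (p : {perm T}) (x : T) (F : T -> R) :
  \big[op/idx]_(y in porbit p x) F y =
  \big[op/idx]_(y <- traject p x #|porbit p x|) F y.
Proof.
rewrite big_uniq ?uniq_traject_porbit //.
by apply: eq_bigl => y; rewrite porbit_traject.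
Qed.

(** Several faces may have the same vertex set, and the hypergraph counts that
    set once. *)
Lemma sum_imset_le (R : numDomainType) (S T : finType) (h : S -> T)
    (A : {set S}) (F : T -> R) :
  (forall t, 0 <= F t) -> \sum_(t in h @: A) F t <= \sum_(a in A) F (h a).
Proof.
move=> F_ge0; rewrite [leRHS](partition_big_imset h) /=.
apply: ler_sum => _ /imsetP[a aA ->].
by rewrite (bigD1 a) ?aA ?eqxx //= lerDl; apply: sumr_ge0.
Qed.

(** With p, q, r, t the weights of consecutive vertices, this is the sum of
    2(pq)(rt) <= (pq)^2 + (rt)^2 and 2(qr)(tp) <= (qr)^2 + (tp)^2. *)
Lemma face_product_le (R : realDomainType) (V : finType) (G : sgraph V)
    (s : rotation G) (f : {set dart G}) (x : V -> R) :
  f \in faces s -> bounded_by_cycle 4 f ->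
  4 * \prod_(v in [set tail d | d in f]) x v <=
  \sum_(d in f) x (tail d) ^+ 2 * x (tip d) ^+ 2.
Proof.
move=> fF [f4 tail_inj]; rewrite big_imset //.
case/imsetP: fF f4 => d _ -> f4.
have := iter_porbit (face_perm s) d; rewrite !big_porbit f4 /= => d4.
rewrite !big_cons !big_nil -!(tail_face_perm s) d4 mulr1 addr0.
move: (x (tail d)) (x (tail (face_perm s d))) => p q.
move: (x (tail _)) (x (tail _)) => t r.
have := sqr_ge0 (p * q - r * t); have := sqr_ge0 (q * r - t * p); nra.
Qed.

Lemma hpoly_face_le (R : realType) (V : finType) (G : sgraph V)
    (s : rotation G) (x : V -> R) :
  (forall f, f \in faces s -> bounded_by_cycle 4 f) -> (forall v, 0 <= x v) ->
  hpoly 4 (face_hypergraph s) x <= \sum_d x (tail d) ^+ 2 * x (@tip V G d) ^+ 2.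
Proof.
move=> cycles x_ge0; rewrite -(sum_faces s).
apply: (@le_trans _ _ (\sum_(f in faces s)
    4 * \prod_(v in [set tail d | d in f]) x v)); last first.
  by apply: ler_sum => f fF; exact: (face_product_le x fF (cycles f fF)).
rewrite -mulr_sumr ler_wpM2l //.
apply: (@sum_imset_le _ _ _ _ _ (fun e : {set V} => \prod_(v in e) x v)) => e.
exact: prodr_ge0.
Qed.

(** * Edge sums in bipartite graphs *)

Lemma sum_darts_out (R : nmodType) (V : finType) (G : sgraph V)
    (c : V -> bool) (W : V -> V -> R) :
  \sum_(d : dart G | c (tail d)) W (tail d) (tip d) =
  \sum_(p | G p.1 p.2 && c p.1) W p.1 p.2.
Proof.
exact: (esym (big_sub_cond (I := (V * V)%type) (fun p => G p.1 p.2)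
  (fun p => c p.1) (fun p => W p.1 p.2))).
Qed.

Lemma sum_darts_half (R : nmodType) (V : finType) (G : sgraph V)
    (c : V -> bool) (X : dart G -> R) :
  (forall d : dart G, c (tail d) != c (tip d)) ->
  (forall d, X (dart_rev d) = X d) ->
  \sum_d X d = (\sum_(d : dart G | c (tail d)) X d) *+ 2.
Proof.
move=> cP Xrev; rewrite (bigID (fun d : dart G => c (tail d))) /= mulr2n.
congr (_ + _); rewrite (reindex_inj (can_inj (@dart_revK V G))) /=.
apply: eq_big => [d|d _]; last exact: Xrev.
by have := cP d; rewrite /tail /tip /=; do 2 case: (c _).
Qed.

Lemma card_out_edges (V : finType) (G : sgraph V) (c : V -> bool) :
  (forall d : dart G, c (tail d) != c (tip d)) ->
  (\sum_(d : dart G | c (tail d)) 1)%N = #|edges G|.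
Proof.
move=> cP; have := card_darts_edges G.
have half := @sum_darts_half nat V G c (fun=> 1%N) cP (fun=> erefl).
have -> : #|dart G| = (\sum_(d : dart G) 1)%N by rewrite sum1_card.
rewrite [X in X = _]half; set k := (X in X *+ 2).
by rewrite mulr2n [k + k]addnn mul2n => /double_inj.
Qed.

(** The proof that a bipartite graph with t^2 edges has spectral radius at most
    t, with its defect made explicit.  If a and b are the sums of the y_v^2
    over the two classes, and z_uv = y_u y_v, then
    ab = 1/4 - (a - 1/2)^2 splits into the sum of z^2 over the edges
    and over the non-edges between the classes, while
    2z = 2t z^2 + 1/(2t) - (2t z - 1)^2 / (2t) on each edge. *)
Lemma dart_sum_slack (R : realFieldType) (V : finType) (G : sgraph V)
    (c : V -> bool) (y : V -> R) (t : R) :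
  (forall d : dart G, c (tail d) != c (tip d)) ->
  \sum_v y v ^+ 2 = 1 -> 0 < t -> t ^+ 2 = #|edges G|%:R ->
  t - \sum_d y (tail d) * y (@tip V G d) =
    (\sum_(d : dart G | c (tail d)) (2 * t * (y (tail d) * y (tip d)) - 1) ^+ 2)
      / (2 * t)
    + 2 * t * (\sum_(p : V * V | [&& c p.1, ~~ c p.2 & ~~ G p.1 p.2])
                 (y p.1 * y p.2) ^+ 2)
    + 2 * t * (\sum_(v | c v) y v ^+ 2 - 2^-1) ^+ 2.
Proof.
move=> cP y1 t_gt0 t2.
pose a := \sum_(v | c v) y v ^+ 2; pose b := \sum_(v | ~~ c v) y v ^+ 2.
have ab1 : a + b = 1 by rewrite -y1 [RHS](bigID c).
pose z (d : dart G) := y (tail d) * y (tip d).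
pose S1 := \sum_(d : dart G | c (tail d)) z d.
pose S2 := \sum_(d : dart G | c (tail d)) z d ^+ 2.
have sumz : \sum_d z d = 2 * S1.
  by rewrite (sum_darts_half cP) ?mulr_natl // => d; rewrite /z mulrC.
pose N := \sum_(p : V * V | [&& c p.1, ~~ c p.2 & ~~ G p.1 p.2])
                 (y p.1 * y p.2) ^+ 2.
have abE : a * b = S2 + N.
  rewrite /a /b big_distrlr pair_big /= (bigID (fun p => G p.1 p.2)) /=.
  congr (_ + _); last by apply: eq_big => [p|p _]; rewrite ?andbA ?exprMn.
  rewrite /S2 (sum_darts_out G c (fun u v => (y u * y v) ^+ 2)).
  apply: eq_big => [[u v]|p _] /=; last by rewrite exprMn.
  have [Guv|] := boolP (G u v); last by rewrite !andbF.
  have := cP (exist _ (u, v) Guv); rewrite /tail /tip /= andbT.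
  by do 2 case: (c _).
have -> : \sum_(d : dart G | c (tail d)) (2 * t * z d - 1) ^+ 2 =
    4 * t ^+ 2 * S2 - 4 * t * S1 + t ^+ 2.
  rewrite [X in _ + X]t2 -(card_out_edges cP) natr_sum.
  rewrite !mulr_sumr -sumrB -big_split /=; apply: eq_bigr => d _; ring.
rewrite sumz -/a -/N.
have -> : N = a * (1 - a) - S2 by rewrite -ab1; lra.
field.
by rewrite gt_eqF.
Qed.

Lemma dart_sum_le (R : realFieldType) (V : finType) (G : sgraph V)
    (c : V -> bool) (y : V -> R) (t : R) :
  (forall d : dart G, c (tail d) != c (tip d)) ->
  \sum_v y v ^+ 2 = 1 -> 0 < t -> t ^+ 2 = #|edges G|%:R ->
  \sum_d y (tail d) * y (@tip V G d) <= t.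
Proof.
move=> cP y1 t_gt0 t2; rewrite -subr_ge0 (dart_sum_slack cP y1 t_gt0 t2).
have tt_ge0 : 0 <= 2 * t by lra.
apply: addr_ge0; last by rewrite mulr_ge0 ?sqr_ge0.
apply: addr_ge0.
  by apply: divr_ge0 => //; apply: sumr_ge0 => d _; exact: sqr_ge0.
by apply: mulr_ge0 => //; apply: sumr_ge0 => p _; exact: sqr_ge0.
Qed.

(** When the defect vanishes, every edge has 2t y_u y_v = 1, so [y] vanishes
    nowhere, and then a missing edge between the classes would contribute to
    the defect. *)
Lemma dart_sum_eq_complete (R : realFieldType) (V : finType) (G : sgraph V)
    (c : V -> bool) (y : V -> R) (t : R) :
  (forall d : dart G, c (tail d) != c (tip d)) ->
  (forall v, exists d : dart G, tail d = v) ->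
  \sum_v y v ^+ 2 = 1 -> 0 < t -> t ^+ 2 = #|edges G|%:R ->
  t <= \sum_d y (tail d) * y (@tip V G d) ->
  forall u v, c u -> ~~ c v -> G u v.
Proof.
move=> cP dartP y1 t_gt0 t2 t_le.
have := dart_sum_slack cP y1 t_gt0 t2.
set S := \sum_(d : dart G | c _) _; set N := \sum_(p : V * V | _) _.
set Q := _ ^+ 2.
move=> slack.
have S_ge0 : 0 <= S by apply: sumr_ge0 => *; exact: sqr_ge0.
have N_ge0 : 0 <= N by apply: sumr_ge0 => *; exact: sqr_ge0.
have Q_ge0 : 0 <= 2 * t * Q by rewrite mulr_ge0 ?sqr_ge0 //; lra.
have SN0 : S / (2 * t) + 2 * t * N <= 0 by lra.
have S0 : S = 0.
  apply: le_anti; rewrite S_ge0 andbT -(pmulr_lle0 _ (x := (2 * t)^-1));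
    last by rewrite invr_gt0; lra.
  have : 0 <= 2 * t * N by rewrite mulr_ge0 //; lra.
  lra.
have N0 : N = 0.
  apply: le_anti; rewrite N_ge0 andbT -(pmulr_rle0 _ (x := 2 * t)); last by lra.
  have : 0 <= S / (2 * t) by rewrite divr_ge0 //; lra.
  lra.
have z_neq0 (d : dart G) : c (tail d) -> y (tail d) * y (tip d) != 0.
  move=> cd; have /eqP := psumr_eq0P (fun d _ => sqr_ge0 _) S0 cd.
  rewrite sqrf_eq0; apply: contraTneq => ->.
  by rewrite mulr0 sub0r oppr_eq0 oner_eq0.
have y_neq0 v : y v != 0.
  have [d <-] := dartP v; have [cd|ncd] := boolP (c (tail d)).
    by have := z_neq0 d cd; rewrite mulf_eq0 negb_or => /andP[].
  have c_rev : c (tail (dart_rev d)).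
    by have := cP d; rewrite (negbTE ncd) eq_sym eqbF_neg negbK.
  by have := z_neq0 _ c_rev; rewrite mulf_eq0 negb_or => /andP[].
move=> u v cu cv; apply: contraTT isT => nG.
have := psumr_eq0P (fun p _ => sqr_ge0 _) N0 (i := (u, v)).
rewrite /= cu cv nG => /(_ isT) /eqP.
by rewrite sqrf_eq0 mulf_eq0 !(negbTE (y_neq0 _)).
Qed.

(** Counting darts by faces and by edges gives 4F = 2E, and then Euler's formula
    gives E = 2(V - 2). *)
Lemma quadrangulation_edges (V : finType) (G : sgraph V) (s : rotation G) :
  closed_4_angulation s -> #|edges G| = (2 * (#|V| - 2))%N.
Proof.
case=> -[V_gt2 _ _] euler cycles.
have : #|dart G| = (#|faces s| * 4)%N.
  have -> : #|dart G| = (\sum_(d : dart G) 1)%N by rewrite sum1_card.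
  rewrite -(sum_faces s (fun=> 1%N)) -sum_nat_const; apply: eq_bigr => f fF.
  by rewrite sum1_card; have [] := cycles f fF.
rewrite card_darts_edges; move: euler V_gt2; rewrite /spherical.
move: #|V| #|edges G| #|faces s| => v e f; lia.
Qed.

Lemma complete_bipartite_edges (V : finType) (G : sgraph V) (c : V -> bool) :
  (forall d : dart G, c (tail d) != c (tip d)) ->
  (forall u v, c u -> ~~ c v -> G u v) ->
  #|edges G| = (#|[set v | c v]| * #|[set v | ~~ c v]|)%N.
Proof.
move=> cP complete; rewrite -cardsX -(card_out_edges cP).
rewrite (sum_darts_out (R := nat) G c (fun _ _ => 1%N)) -sum1_card.
apply: eq_bigl => -[u v]; rewrite !inE /=.
apply/andP/andP => -[h1 h2]; split => //; last exact: complete.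
by have := cP (exist _ (u, v) h1); rewrite /tail /tip /= h2; case: (c v).
Qed.

(** The class sizes satisfy pq = 2(p + q - 2), that is (p - 2)(q - 2) = 0. *)
Lemma complete_quadrangulation_part (V : finType) (G : sgraph V)
    (s : rotation G) (c : V -> bool) :
  closed_4_angulation s ->
  (forall d : dart G, c (tail d) != c (tip d)) ->
  (forall u v, c u -> ~~ c v -> G u v) -> (5 <= #|V|)%N ->
  #|[set v | c v]| = 2%N \/ #|[set v | ~~ c v]| = 2%N.
Proof.
move=> quad cP complete V_ge5.
have := quadrangulation_edges quad.
rewrite (complete_bipartite_edges cP complete).
have : (#|[set v | c v]| + #|[set v | ~~ c v]|)%N = #|V|.
  rewrite -(cardsC [set v | c v]); congr (_ + _)%N.
  by apply: eq_card => v; rewrite !inE.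
move: V_ge5; move: #|V| #|[set v | c v]| #|[set v | ~~ c v]| => n p q.
case: p => [|[|[|p]]]; case: q => [|[|[|q]]]; try lia; nia.
Qed.

(** * Rotations of complete bipartite graphs with a class of size two *)

Lemma face4_tails (V : finType) (G : sgraph V) (s : rotation G) (d : dart G) :
  bounded_by_cycle 4 (porbit (face_perm s) d) ->
  let p := face_perm s in
  [/\ p (p (p (p d))) = d, tail d != tail (p (p d)) &
      [set tail e | e in porbit p d] =
      [set tail d; tail (p (p d)); tail (p (p (p d))); tail (p d)]].
Proof.
move=> [card4 tail_inj] p.
have p4 := iter_porbit (face_perm s) d; rewrite card4 /= in p4.
have mem_p := porbit_traject (face_perm s) d; rewrite card4 /= in mem_p.
have := uniq_traject_porbit (face_perm s) d; rewrite card4 /= -/p in mem_p *.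
rewrite !inE !negb_or -!andbA => /and4P[_ d02 _ _].
have tail_neq e e' : e \in porbit p d -> e' \in porbit p d -> e != e' ->
    tail e != tail e'.
  by move=> he he'; apply: contra_neq; exact: tail_inj.
split=> //; try by apply: tail_neq; rewrite // mem_p !inE eqxx ?orbT.
apply/setP => v; apply/idP/idP => [/imsetP[e]|].
  by rewrite mem_p !inE => /or4P[] /eqP -> ->; rewrite eqxx ?orbT.
rewrite !inE -!orbA => /or4P[] /eqP ->; apply: imset_f;
  by rewrite mem_p !inE eqxx ?orbT.
Qed.

Section CompleteBipartite.
Variables (V : finType) (G : sgraph V) (s : rotation G) (c : V -> bool).
Variables (a b : V).
Hypothesis cycles : forall f, f \in faces s -> bounded_by_cycle 4 f.
Hypothesis cP : forall d : dart G, c (tail d) != c (tip d).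
Hypothesis c_ab : forall v, c v = (v == a) || (v == b).

(** Two consecutive darts at [a] bound a corner of a face, which visits [a], the
    tip of the second dart, the only other vertex [b] of the class of [a], and
    the tip of the first dart. *)
Lemma face_at_pole (d : dart G) : tail d = a ->
  [set tail e | e in porbit (face_perm s) (s d)] =
  [set a; b; tip d; tip (s d)].
Proof.
move=> da; have sF : porbit (face_perm s) (s d) \in faces s by exact: imset_f.
have [p4 n02 ->] := face4_tails (cycles sF).
set p := face_perm s in p4 n02 *.
have sda : tail (s d) = a by rewrite tail_rotation.
have rev3 : dart_rev (p (p (p (s d)))) = d.
  by apply: (@perm_inj _ s); rewrite -face_perm_rev dart_revK.
have -> : tail (p (p (p (s d)))) = tip d by have := congr1 (@tip V G) rev3.
have p2b : tail (p (p (s d))) = b.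
  have : c (tail (p (p (s d)))).
    have := cP (p (s d)); have := cP (s d).
    rewrite -!(tail_face_perm s) -/p sda.
    by rewrite c_ab eqxx /=; do 2 case: (c _).
  by rewrite c_ab eq_sym -sda (negbTE n02) /= => /eqP.
by rewrite sda p2b tail_face_perm.
Qed.

Lemma face_has_pole f : f \in faces s ->
  exists2 d, tail d = a & f = porbit (face_perm s) (s d).
Proof.
move=> fF.
suff [e ef ea] : exists2 e, e \in f & tail e = a.
  exists ((s : {perm dart G})^-1%g e); last first.
    by rewrite permKV; exact: face_permE.
  by rewrite -ea -[in RHS](permKV s e) tail_rotation.
have [d df] : exists d, d \in f.
  by case/imsetP: fF => d _ ->; exists d; exact: porbit_id.
have fE := face_permE fF df.
have [e ef ce] : exists2 e, e \in f & c (tail e).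
  have [cd|ncd] := boolP (c (tail d)); first by exists d.
  exists (face_perm s d).
    by have := mem_porbit (face_perm s) 1 d; rewrite fE expg1.
  by have := cP d; rewrite tail_face_perm (negbTE ncd) eq_sym eqbF_neg negbK.
have fE' := face_permE fF ef.
have cycle_e : bounded_by_cycle 4 (porbit (face_perm s) e).
  by rewrite -fE'; exact: cycles.
have [_ n02 _] := face4_tails cycle_e.
move: ce; rewrite c_ab => /orP[]/eqP ea; first by exists e.
exists (face_perm s (face_perm s e)).
  by have := mem_porbit (face_perm s) 2 e; rewrite expgS expg1 permM fE'.
have : c (tail (face_perm s (face_perm s e))).
  have := cP (face_perm s e); have := cP e; rewrite -!(tail_face_perm s).
  by rewrite [c (tail e)]c_ab ea eqxx orbT; do 2 case: (c _).
by rewrite c_ab => /orP[]/eqP // ppe; move: n02; rewrite ppe ea eqxx.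
Qed.

Hypothesis complete : forall u v, c u -> ~~ c v -> G u v.
Hypothesis neq_ab : a != b.

(** The rotation at [a] runs through the darts from [a] to all vertices of the
    other class, so its iterates number that class cyclically, and
    [face_at_pole] identifies the faces with the pairs of consecutive
    numbers. *)
Lemma complete_iso_K2 (n : nat) : (5 <= n)%N -> #|V| = n ->
  hypergraph_iso (face_hypergraph s) (face_hypergraph_K2 (n - 2)).
Proof.
move=> n5 Vn.
have cA : c a by rewrite c_ab eqxx.
have cB : c b by rewrite c_ab eqxx orbT.
pose B := [set v | ~~ c v].
have cardB : #|B| = (n - 2)%N.
  have -> : B = ~: [set a; b] by apply/setP => v; rewrite !inE c_ab.
  by rewrite cardsCs setCK cards2 neq_ab Vn.
have [u0 u0B] : exists u, u \in B by apply/card_gt0P; rewrite cardB; lia.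
have Gau u : u \in B -> G a u by rewrite inE; exact: complete.
pose d0 : dart G := exist _ (a, u0) (Gau u0 u0B).
have tail_s i : tail (iter i s d0) = a.
  by elim: i => //= i; rewrite tail_rotation.
have tip_B (d : dart G) : tail d = a -> tip d \in B.
  by move=> da; have := cP d; rewrite inE da cA; case: (c _).
have card_orb : #|porbit s d0| = (n - 2)%N.
  rewrite -cardB -(card_in_imset (f := @tip V G)); last first.
    move=> d d'; rewrite !porbit_traject => /trajectP[i _ ->] /trajectP[j _ ->].
    by apply: dart_inj; rewrite !tail_s.
  apply: eq_card => v; apply/imsetP/idP => [[d]|vB].
    by rewrite porbit_traject => /trajectP[i _ ->] ->; apply/tip_B/tail_s.
  by exists (exist _ (a, v) (Gau v vB)) => //; apply: rotation_transitive.
pose g (w : bool + 'I_(n - 2)) : V :=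
  match w with inl false => a | inl true => b | inr i => tip (iter i s d0) end.
have g_inj : injective g.
  have tip_c i : ~~ c (tip (iter i s d0)).
    by have := tip_B _ (tail_s i); rewrite inE.
  move=> [[]|i] [[]|j] //= gij.
  - by move: neq_ab; rewrite gij eqxx.
  - by have := tip_c j; rewrite -gij cB.
  - by move: neq_ab; rewrite gij eqxx.
  - by have := tip_c j; rewrite -gij cA.
  - by have := tip_c i; rewrite gij cB.
  - by have := tip_c i; rewrite gij cA.
  congr inr; apply/val_inj/eqP => /=.
  have := uniq_traject_porbit s d0; rewrite card_orb => /(nth_uniq d0) <-;
    rewrite ?size_traject ?nth_traject //.
  by apply/eqP/dart_inj; rewrite ?tail_s.
have [g' gK g'K] : bijective g.
  by apply: inj_card_bij => //; rewrite card_sum card_bool card_ord Vn; lia.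
exists g'; first by exists g.
have g_edge (i : 'I_(n - 2)) :
    [set g w | w in [set inl false; inl true; inr i; inr (ordS i)]] =
    [set a; b; tip (iter i s d0); tip (iter i.+1 s d0)].
  rewrite !imsetU !imset_set1 /=.
  suff -> : iter (i.+1 %% (n - 2)) s d0 = s (iter i s d0) by [].
  have [lt_i|] := ltnP i.+1 (n - 2); first by rewrite modn_small.
  rewrite leq_eqVlt ltnNge (ltn_ord i) orbF => /eqP ei.
  by rewrite -ei modnn /= -[RHS]/(iter i.+1 s d0) -ei -card_orb iter_porbit.
have imK (e : {set bool + 'I_(n - 2)}) : [set g' v | v in g @: e] = e.
  by rewrite -imset_comp (eq_imset (g := id)) ?imset_id.
rewrite /face_hypergraph -imset_comp; apply/setP => e.
apply/imsetP/imsetP => [[f fF ->]|[i _ ->]] /=.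
  have [d da ->] := face_has_pole fF; rewrite face_at_pole //.
  have : d \in porbit s d0 by apply: rotation_transitive; rewrite da.
  rewrite porbit_traject card_orb => /trajectP[i lt_i ->].
  by exists (Ordinal lt_i) => //; rewrite -[RHS]imK g_edge.
exists (porbit (face_perm s) (s (iter i s d0))); first exact: imset_f.
by rewrite face_at_pole // -[LHS]imK g_edge.
Qed.
End CompleteBipartite.

(** * The face hypergraph of K_{2,m} attains the bound *)

(** For m = 2 this fails: {0, 1} and {1, 0} are the same pair. *)
Lemma K2_face_inj (m : nat) : (3 <= m)%N ->
  injective (fun i : 'I_m =>
    [set inl false; inl true; inr i; inr (ordS i)] : {set bool + 'I_m}).
Proof.
move=> m3 i j /setP eq_ij.
have mem_j k : (k == i) || (k == ordS i) = (k == j) || (k == ordS j).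
  by have := eq_ij (inr k); rewrite !inE.
have := mem_j i; rewrite eqxx /= => /esym/orP[/eqP//|/eqP ij].
have := mem_j j; rewrite eqxx /= => /orP[/eqP//|/eqP ji].
apply/val_inj => /=; move: (congr1 val ij) (congr1 val ji) => /=.
have last_ord (k : 'I_m) : (m <= k.+1)%N -> k.+1 = m.
  by have := ltn_ord k; lia.
have [lti|/last_ord ei] := ltnP i.+1 m.
  have [ltj|/last_ord ej] := ltnP j.+1 m.
    by rewrite !modn_small //; lia.
  by rewrite ej modnn modn_small //; lia.
rewrite ei modnn => + j0; rewrite j0 modn_small; lia.
Qed.

Lemma ordS_neq (m : nat) (i : 'I_m) : (2 <= m)%N -> i != ordS i.
Proof.
move=> m2; apply/eqP => /(congr1 val) /=.
have [lti|gei] := ltnP i.+1 m; first by rewrite modn_small //; lia.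
have ei : i.+1 = m by have := ltn_ord i; lia.
by rewrite ei modnn; lia.
Qed.

Lemma hpoly_iso (R : realType) (V W : finType) (k : nat) (f : V -> W)
    (H : hypergraph V) (z : W -> R) :
  injective f -> hpoly k H (z \o f) = hpoly k [set f @: e | e : {set V} in H] z.
Proof.
move=> f_inj; rewrite /hpoly big_imset; last first.
  by move=> e e' _ _; exact: imset_inj.
congr (_ * _); apply: eq_bigr => e _.
by rewrite big_imset //= => v w _ _ /f_inj.
Qed.

(** The witness balances the total weight between the two classes: the fourth
    powers add up to 1/2 over each of them. *)
Lemma spectral_radius_K2_ge (R : realType) (V : finType) (m : nat)
    (H : hypergraph V) :
  (3 <= m)%N -> hypergraph_iso H (face_hypergraph_K2 m) ->
  Num.sqrt (2 * m%:R) <= spectral_radius R 4 H.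
Proof.
move=> m3 [f f_bij fH]; set r : R := Num.sqrt (2 * m%:R).
have m_gt0 : 0 < m%:R :> R by rewrite ltr0n; lia.
have r_gt0 : 0 < r by rewrite sqrtr_gt0; lra.
have r2 : r ^+ 2 = 2 * m%:R by rewrite sqr_sqrtr //; lra.
pose al : R := Num.sqrt 2^-1; pose be : R := Num.sqrt r^-1.
have al2 : al ^+ 2 = 2^-1 by rewrite sqr_sqrtr //; lra.
have be2 : be ^+ 2 = r^-1 by rewrite sqr_sqrtr // invr_ge0 ltW.
pose z (w : bool + 'I_m) : R := if w is inl _ then al else be.
have f_inj := bij_inj f_bij.
have V_gt0 : (0 < #|V|)%N.
  by rewrite (bij_eq_card f_bij); apply/card_gt0P; exists (inl true).
have [x _ [-> max_x]] := spectral_radius_max R H (isT : 0 < 4)%N V_gt0.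
have sphere_z : nonneg_sphere 4 (z \o f).
  split=> [v|]; first by rewrite /= /z; case: (f v) => _; exact: sqrtr_ge0.
  have [g fK gK] := f_bij.
  rewrite (reindex g) /=; last by exists f => ? _; rewrite ?fK ?gK.
  under eq_bigr do rewrite gK.
  rewrite big_sumType /= big_bool /= sumr_const card_ord.
  rewrite -[4%N]/(2 * 2)%N !exprM al2 be2 !exprVn r2 -mulr_natl.
  by field; rewrite gt_eqF.
apply: le_trans (max_x _ sphere_z); rewrite (hpoly_iso _ _ _ f_inj) fH.
rewrite /hpoly big_imset /=; last by move=> i j _ _; exact: K2_face_inj.
rewrite (eq_bigr (fun=> al ^+ 2 * be ^+ 2)) => [|i _]; last first.
  rewrite -!setUA !big_setU1 ?big_set1 ?inE //=.
    by rewrite /z; ring.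
  by apply: ordS_neq; lia.
rewrite sumr_const card_ord al2 be2 -mulr_natl.
rewrite -[leLHS](mulfK (lt0r_neq0 r_gt0)) -expr2 r2.
by rewrite le_eqVlt; apply/orP; left; apply/eqP; field; exact: lt0r_neq0.
Qed.

(** * The spectral radius of planar hypergraphs *)

Unset Implicit Arguments.

Theorem theorem1p4 (R : realType) (n : nat) (hn : (5 <= n)%N)
    (V : finType) (hV : #|V| = n) (H : hypergraph V)
    (hH : planar_4_uniform H) :
  spectral_radius R 4 H <= Num.sqrt (2 * (n - 2)%:R) /\
  (spectral_radius R 4 H = Num.sqrt (2 * (n - 2)%:R) <->
   hypergraph_iso H (face_hypergraph_K2 (n - 2))).
Proof.
have [G [s [quad ->]]] := hH.
have [[V_gt2 conn _] euler cycles] := quad.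
have V_gt1 : (1 < #|V|)%N by lia.
have V_gt0 : (0 < #|V|)%N by lia.
have [c cP] : exists c : V -> bool, forall d : dart G, c (tail d) != c (tip d).
  apply: (spherical_bipartite conn euler) => f fF.
  by have [-> _] := cycles f fF.
set t : R := Num.sqrt _.
have m_gt0 : 0 < (n - 2)%:R :> R by rewrite ltr0n; lia.
have t_gt0 : 0 < t by rewrite sqrtr_gt0; lra.
have t2 : t ^+ 2 = #|edges G|%:R.
  by rewrite (quadrangulation_edges quad) hV natrM sqr_sqrtr //; lra.
have [x [x_ge0 x4] [radiusE _]] :=
  spectral_radius_max R (face_hypergraph s) (isT : 0 < 4)%N V_gt0.
pose y v := x v ^+ 2.
have y1 : \sum_v y v ^+ 2 = 1.
  by rewrite -x4; apply: eq_bigr => v _; rewrite -exprM.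
have radius_le : spectral_radius R 4 (face_hypergraph s) <=
    \sum_d y (tail d) * y (@tip V G d).
  by rewrite radiusE; exact: hpoly_face_le.
have le_t := le_trans radius_le (dart_sum_le cP y1 t_gt0 t2).
split=> //; split=> [radius_t|iso].
  have dartP := dart_from conn V_gt1.
  have complete : forall u v, c u -> ~~ c v -> G u v.
    by apply: (dart_sum_eq_complete cP dartP y1 t_gt0 t2); rewrite -radius_t.
  have V_ge5 : (5 <= #|V|)%N by rewrite hV.
  have [c2|c2] := complete_quadrangulation_part quad cP complete V_ge5.
    have /cards2P[a [b [neq_ab cE]]] : #|[set v | c v]| == 2%N by rewrite c2.
    have c_ab v : c v = (v == a) || (v == b).
      by have /setP/(_ v) := cE; rewrite !inE.
    exact: (complete_iso_K2 cycles cP c_ab complete neq_ab hn hV).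
  have /cards2P[a [b [neq_ab cE]]] : #|[set v | ~~ c v]| == 2%N by rewrite c2.
  have c_ab v : ~~ c v = (v == a) || (v == b).
    by have /setP/(_ v) := cE; rewrite !inE.
  have cP' (d : dart G) : ~~ c (tail d) != ~~ c (tip d).
    by have := cP d; do 2 case: (c _).
  have complete' u v : ~~ c u -> ~~ ~~ c v -> G u v.
    by move=> cu /negbNE cv; rewrite adj_sym; exact: complete.
  exact: (complete_iso_K2 cycles cP' c_ab complete' neq_ab hn hV).
apply: le_anti; rewrite le_t /=; apply: spectral_radius_K2_ge iso; lia.
Qed.
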